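(* Let $T_0 \in \mathcal{G}(X)$ be antiperiodic and rigid. Then $\mathcal{S}_{T_0}$ is a first category subset of $\mathcal{G}_{T_0}$.
   Context: Let $(X,m)$ and $(Y,\nu)$ both be the unit interval with Lebesgue measure, and $(Z,\mu) = (X\times Y, m\times\nu)$. $\mathcal{G}(W)$ denotes the set of invertible measure-preserving transformations of a space $W$, with the weak topology ($T_n \to T$ iff $\mu(T_nE \triangle TE) \to 0$ for every measurable $E$). $T_0$ is antiperiodic if its set of periodic points has measure zero, and rigid if there is a subsequence $n_k$ with $T_0^{n_k}\to\mathrm{id}_X$ strongly as Koopman operators on $L^2(X)$. $\mathcal{G}_{T_0} \subset \mathcal{G}(Z)$ is the set of transformations of the form $T(x,y) = (T_0x, T_x y)$ with $T_x \in \mathcal{G}(Y)$ (extensions of $T_0$), with the relative weak topology; $T_0$ is identified with $T_0\times\mathrm{id}_Y$. $\mathbb{E}(\cdot|X)$ is conditional expectation onto the $\sigma$-algebra of sets $B\times Y$. $L^2(Z|X)$ is the space of $f\in L^2(Z)$ with $\mathbb{E}(|f|^2|X)^{1/2} \in L^\infty(X)$. $T\in\mathcal{G}_{T_0}$ is a strongly mixing extension of $T_0$ if for all $f,g\in L^2(Z|X)$, $\lim_{n\to\infty}\|\mathbb{E}(T^n f\cdot\overline{g}|X) - T_0^n\mathbb{E}(f|X)\mathbb{E}(\overline{g}|X)\|_{L^2(X)} = 0$, where $T^nf = f\circ T^n$; $\mathcal{S}_{T_0}$ is the set of such extensions. *)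

(* Defs.v *)
From HB Require Import structures.
From mathcomp Require Import all_boot all_order all_algebra.
From mathcomp Require Import all_classical all_reals all_analysis.
Import Order.TTheory GRing.Theory Num.Theory.
Unset Printing Implicit Defensive.
Local Open Scope classical_set_scope.
Local Open Scope ring_scope.

(* The unit interval with Lebesgue measure: the real line (Borel sets)
   with Lebesgue measure restricted to [0,1].  Up to null sets this is
   exactly ([0,1], Lebesgue). *)
Definition unit_itv (R : realType) : set (measurableTypeR R) := `[0%R, 1%R].

Lemma measurable_unit_itv (R : realType) : measurable (unit_itv R).
Proof. exact: measurable_itv. Qed.

Definition leb01 (R : realType) : set (measurableTypeR R) -> \bar R :=
  mrestr (@lebesgue_measure R) (measurable_unit_itv R).

HB.instance Definition _ (R : realType) := Measure.on (@leb01 R).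

Lemma leb01_fin (R : realType) : fin_num_fun (@leb01 R).
Proof.
move=> A mA; rewrite ge0_fin_numE; last exact: measure_ge0.
rewrite /leb01 /mrestr.
have mI := measurable_unit_itv R.
have h1 : lebesgue_measure (unit_itv R) = 1%E.
  by rewrite /unit_itv lebesgue_measure_itv /= lte01 EFinN sube0.
apply: (@le_lt_trans _ _ (lebesgue_measure (unit_itv R))).
  by apply: le_measure; rewrite ?inE //; exact: measurableI.
by rewrite h1 ltry.
Qed.

HB.instance Definition _ (R : realType) :=
  @Measure_isFinite.Build _ _ _ (@leb01 R) (@leb01_fin R).

Definition leb01sq (R : realType) : set (measurableTypeR R * measurableTypeR R) -> \bar R :=
  (@leb01 R \x @leb01 R)%E.

HB.instance Definition _ (R : realType) := Measure.on (@leb01sq R).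

Definition measure_preserving {d} {T : measurableType d} {R : realType}
    (mu : set T -> \bar R) (f : T -> T) :=
  measurable_fun setT f /\ forall A, measurable A -> mu (f @^-1` A) = mu A.

Definition inv_mpt {d} {T : measurableType d} {R : realType}
    (mu : set T -> \bar R) (f : T -> T) :=
  exists g : T -> T, [/\ cancel f g, cancel g f,
    measure_preserving mu f & measure_preserving mu g].

Definition weak_open {d} {T : measurableType d} {R : realType}
    (mu : set T -> \bar R) (G : set (T -> T)) (U : set (T -> T)) :=
  U `<=` G /\
  forall S0, U S0 -> exists (Es : seq (set T)) (eps : R),
    [/\ 0 < eps, (forall E, E \in Es -> measurable E) &
      [set S | G S /\ forall E, E \in Es -> (mu ((S @` E) `+` (S0 @` E)) < eps%:E)%E]
        `<=` U].

Definition weak_closure {d} {T : measurableType d} {R : realType}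
    (mu : set T -> \bar R) (G : set (T -> T)) (N : set (T -> T)) :=
  [set S | G S /\ forall U, weak_open mu G U -> U S -> U `&` N !=set0].

Definition weak_interior {d} {T : measurableType d} {R : realType}
    (mu : set T -> \bar R) (G : set (T -> T)) (A : set (T -> T)) :=
  [set S | exists U, [/\ weak_open mu G U, U S & U `<=` A]].

Definition weak_nowhere_dense {d} {T : measurableType d} {R : realType}
    (mu : set T -> \bar R) (G : set (T -> T)) (N : set (T -> T)) :=
  N `<=` G /\ weak_interior mu G (weak_closure mu G N) = set0.

Definition weak_first_category {d} {T : measurableType d} {R : realType}
    (mu : set T -> \bar R) (G : set (T -> T)) (A : set (T -> T)) :=
  exists F : nat -> set (T -> T),
    (forall n, weak_nowhere_dense mu G (F n)) /\ A = \bigcup_n F n.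

Definition antiperiodic {R : realType} (T0 : measurableTypeR R -> measurableTypeR R) :=
  (@leb01 R).-negligible [set x | exists n, (0 < n)%N /\ iter n T0 x = x].

Definition L2 {d} {T : measurableType d} {R : realType}
    (mu : {measure set T -> \bar R}) (f : T -> R) :=
  measurable_fun setT f /\ (\int[mu]_x ((f x) ^+ 2)%:E < +oo)%E.

(* T0^{n_k} -> id strongly as Koopman operators f |-> f o T0 on L^2(X). *)
Definition rigid {R : realType} (T0 : measurableTypeR R -> measurableTypeR R) :=
  exists nk : nat -> nat, (forall k, (nk k < nk k.+1)%N) /\
    forall f : measurableTypeR R -> R, L2 (@leb01 R) f ->
      (Lnorm (@leb01 R) 2%:E (fun x => (f (iter (nk k) T0 x) - f x)%:E))%E
        @[k --> \oo] --> 0%E.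

Definition extensions {R : realType} (T0 : measurableTypeR R -> measurableTypeR R) :
    set (measurableTypeR R * measurableTypeR R -> measurableTypeR R * measurableTypeR R) :=
  [set T | [/\ inv_mpt (@leb01sq R) T,
     (forall x y, (T (x, y)).1 = T0 x) &
     (forall x, inv_mpt (@leb01 R) (fun y => (T (x, y)).2))]].

(* conditional expectation onto the sigma-algebra {B x Y}, viewed as a
   function on X: E(h|X)(x) = \int h(x,y) d nu(y). *)
Definition condX {R : realType} (h : measurableTypeR R * measurableTypeR R -> R) :
    measurableTypeR R -> R :=
  fun x => fine (\int[@leb01 R]_y (h (x, y))%:E)%E.

Definition L2_rel {R : realType} (f : measurableTypeR R * measurableTypeR R -> R) :=
  L2 (@leb01sq R) f /\
  exists C : R, {ae @leb01 R, forall x, (\int[@leb01 R]_y ((f (x, y)) ^+ 2)%:E <= C%:E)%E}.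

Definition mixing_extensions {R : realType} (T0 : measurableTypeR R -> measurableTypeR R) :
    set (measurableTypeR R * measurableTypeR R -> measurableTypeR R * measurableTypeR R) :=
  [set T | extensions T0 T /\
    forall f g, L2_rel f -> L2_rel g ->
      (Lnorm (@leb01 R) 2%:E (fun x =>
          (condX (fun z => f (iter n T z) * g z) x
           - condX f (iter n T0 x) * condX g x)%:E))%E
        @[n --> \oo] --> 0%E].

(* Main.v *)
Require Import Defs.
From HB Require Import structures.
From mathcomp Require Import all_boot all_order all_algebra.
From mathcomp Require Import all_classical all_reals all_analysis.
From mathcomp Require Import measurable_realfun.
From mathcomp Require Import ring lra zify.

(* Let E = X * [0, 1/2].  If T is a mixing extension, then the measure of
   T^-n E meeting E tends to 1/4, so T lies outside the set V_n of extensions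
   S with mu (S^k E \triangle E) < 1/8 for some k >= n, once n is large.  Each V_n is
   weakly open, so it remains to see that V_n is dense.  Antiperiodicity gives
   a set A of small measure which almost every backward T0-orbit meets within a
   bounded time.  Copying the fibre maps of S along orbit segments between
   visits to A yields an extension P of the identity such that
   P (T0 * id) P^-1 agrees with S off a set of small measure.  The powers of
   this conjugate along a rigidity sequence of T0 tend weakly to the identity,
   hence it lies in V_n. *)

Import Order.TTheory GRing.Theory Num.Theory.
Import numFieldNormedType.Exports.
Local Open Scope classical_set_scope.
Local Open Scope ring_scope.

(** * Images, iterates and symmetric differences under measure-preserving maps *)

Lemma can2_image_preimage {T U : Type} (f : T -> U) (g : U -> T) (A : set T) :
  cancel f g -> cancel g f -> f @` A = g @^-1` A.
Proof.
move=> fK gK; apply/seteqP; split=> [_ [x Ax <-]|y Ay] /=; first by rewrite fK.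
by exists (g y); rewrite ?gK.
Qed.

Lemma iter_cancel {T : Type} (f g : T -> T) n :
  cancel f g -> cancel (iter n f) (iter n g).
Proof. by move=> fK; elim: n => [//|n IHn] x; rewrite iterSr iterS fK IHn. Qed.

Section MeasurePreserving.
Context {d} {T : measurableType d} {R : realType}.
Variable mu : {measure set T -> \bar R}.
Implicit Types (f g : T -> T) (A B C : set T).

Lemma measurable_preimageT {d'} {U : measurableType d'} (f : T -> U) (A : set U) :
  measurable_fun setT f -> measurable A -> measurable (f @^-1` A).
Proof. by move=> mf mA; rewrite -[_ @^-1` _]setTI; exact: mf. Qed.

Lemma measure_preserving_id : measure_preserving mu id.
Proof. by split => //; exact: measurable_id. Qed.

Lemma measure_preserving_comp f g : measure_preserving mu f ->
  measure_preserving mu g -> measure_preserving mu (f \o g).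
Proof.
move=> [mf pf] [mg pg]; split; first exact: measurableT_comp.
by move=> A mA; rewrite comp_preimage pg ?pf//; exact: measurable_preimageT.
Qed.

Lemma inv_mpt_id : inv_mpt mu id.
Proof. by exists id; split => //; exact: measure_preserving_id. Qed.

Lemma inv_mpt_comp f g : inv_mpt mu f -> inv_mpt mu g -> inv_mpt mu (f \o g).
Proof.
move=> [f' [fK f'K mf mf']] [g' [gK g'K mg mg']]; exists (g' \o f').
by split; [exact: can_comp|exact: can_comp| exact: measure_preserving_comp..].
Qed.

Lemma measure_preserving_iter f n : measure_preserving mu f ->
  measure_preserving mu (iter n f).
Proof.
move=> mf; elim: n => [|n IHn]; first exact: measure_preserving_id.
exact: (measure_preserving_comp _ (iter n f)).
Qed.

Lemma inv_mpt_image f A : inv_mpt mu f -> measurable A ->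
  measurable (f @` A) /\ mu (f @` A) = mu A.
Proof.
move=> [g [fK gK _ [mg pg]]] mA; rewrite (can2_image_preimage _ _ _ fK gK).
by split; [exact: measurable_preimageT|exact: pg].
Qed.

Lemma measurable_setY A B : measurable A -> measurable B -> measurable (A `+` B).
Proof. by move=> mA mB; apply: measurableU; exact: measurableD. Qed.

Lemma measure_setY_triangle A B C : measurable A -> measurable B ->
  measurable C -> (mu (A `+` C) <= mu (A `+` B) + mu (B `+` C))%E.
Proof.
move=> mA mB mC.
apply: le_trans; last exact: (measureU2 mu (measurable_setY _ _ mA mB) (measurable_setY _ _ mB mC)).
apply: le_measure; rewrite ?inE; [exact: measurable_setY| |].
  by apply: measurableU; exact: measurable_setY.
move=> x /=; have [Bx|nBx] := pselect (B x); tauto.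
Qed.

(** Telescoping through [f (g^k A)], since [f] preserves the gap at time [k]. The test sets are
    images under [g] alone, as a basic weak neighbourhood of [g] requires. *)
Lemma iter_image_setY_le (f g : T -> T) A k (e : R) :
  inv_mpt mu f -> inv_mpt mu g -> measurable A ->
  (forall j, (j < k)%N ->
    (mu ((f @` (iter j g @` A)) `+` (g @` (iter j g @` A))) <= e%:E)%E) ->
  (mu ((iter k f @` A) `+` (iter k g @` A)) <= (k%:R * e)%:E)%E.
Proof.
move=> If Ig mA; elim: k => [_|k IHk h].
  by rewrite mul0r setYK measure0.
have mi (u : T -> T) n : inv_mpt mu u -> measurable (iter n u @` A).
  move=> Iu; elim: n => [|n IHn]; first by rewrite image_id.
  rewrite [X in measurable X](_ : _ = u @` (iter n u @` A)); last by rewrite image_comp.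
  exact: (inv_mpt_image _ _ Iu IHn).1.
have mfi (u : T -> T) B : inv_mpt mu u -> measurable B -> measurable (u @` B).
  by move=> Iu mB; exact: (inv_mpt_image _ _ Iu mB).1.
have iS (u : T -> T) : iter k.+1 u @` A = u @` (iter k u @` A) by rewrite image_comp.
rewrite !iS.
apply: le_trans.
  apply: (@measure_setY_triangle _ (f @` (iter k g @` A))).
  - exact/mfi/mi.
  - exact/mfi/mi.
  - exact/mfi/mi.
rewrite -natr1 mulrDl mul1r EFinD; apply: leeD; last exact: h.
have -> : (f @` (iter k f @` A)) `+` (f @` (iter k g @` A)) =
          f @` ((iter k f @` A) `+` (iter k g @` A)).
  by have [f' [fK f'K _ _]] := If; rewrite !(can2_image_preimage _ _ _ fK f'K).
rewrite (inv_mpt_image _ _ If _).2; last by apply: measurable_setY; exact: mi.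
by apply: IHk => j jk; apply: h; exact: ltnW.
Qed.

(** A point that lies in only one image comes from an [x] with [f x] and [g x] different, so the
    symmetric difference is covered by [f D] and [g D]. *)
Lemma image_setY_neq_le (f g : T -> T) A D : inv_mpt mu f -> inv_mpt mu g ->
  measurable A -> measurable D -> (forall x, ~ D x -> f x = g x) ->
  (mu ((f @` A) `+` (g @` A)) <= mu D + mu D)%E.
Proof.
move=> If Ig mA mD fg.
have [mfA _] := inv_mpt_image _ _ If mA; have [mgA _] := inv_mpt_image _ _ Ig mA.
have [mfD fD] := inv_mpt_image _ _ If mD; have [mgD gD] := inv_mpt_image _ _ Ig mD.
rewrite -{1}fD -gD.
apply: le_trans; last exact: (measureU2 mu mfD mgD).
apply: le_measure; rewrite ?inE; [exact: measurable_setY|exact: measurableU|].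
move=> y [[[x Ax <-] ngA]|[[x Ax <-] nfA]]; [left|right]; exists x => //;
  apply: contrapT => /fg E; [apply: ngA|apply: nfA]; exists x => //.
Qed.

Lemma Lnorm2E (h : T -> R) :
  Lnorm mu 2%:E (fun x => (h x)%:E) = ((\int[mu]_x ((h x) ^+ 2)%:E) `^ 2^-1)%E.
Proof.
rewrite unlock; congr (_ `^ _)%E; apply: eq_integral => x _ /=.
by rewrite powR_mulrn// real_normK ?num_real.
Qed.

Lemma Lnorm2_cvg0 (h : nat -> T -> R) :
  (Lnorm mu 2%:E (fun x => (h n x)%:E) @[n --> \oo] --> 0)%E ->
  (\int[mu]_x ((h n x) ^+ 2)%:E @[n --> \oo] --> 0)%E.
Proof.
move=> hc.
have E n : (\int[mu]_x ((h n x) ^+ 2)%:E =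
    Lnorm mu 2%:E (fun x => (h n x)%:E) * Lnorm mu 2%:E (fun x => (h n x)%:E))%E.
  have i0 : (0 <= \int[mu]_x ((h n x) ^+ 2)%:E)%E.
    by apply: integral_ge0 => x _; rewrite lee_fin sqr_ge0.
  by rewrite Lnorm2E poweR12_sqrt// -expe2 sqr_sqrte.
under eq_fun do rewrite E.
by have := cvgeM _ hc hc; rewrite mule0; apply.
Qed.

End MeasurePreserving.

(** * Marker sets by a greedy construction *)

(** Here [g] plays the inverse of [f]. Each stage admits the points of [B j'] whose orbit, fewer
    than [N] steps in either direction, misses the previous stage. *)
Fixpoint greedy_marker {T : Type} (f g : T -> T) (N : nat) (B : nat -> set T)
    (j : nat) : set T :=
  if j is j'.+1 then
    let A := greedy_marker f g N B j' in
    A `|` (B j' `\` \bigcup_(i in `I_N) (iter i f @^-1` A `|` iter i g @^-1` A))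
  else set0.

(** Two new points are kept apart by the hypothesis on [B], and a new point from an old one because
    the removal looks both forward and backward. *)
Lemma greedy_marker_disjoint {T : Type} (f g : T -> T) N (B : nat -> set T) :
  cancel f g ->
  (forall j x i, (0 < i < N)%N -> B j x -> ~ B j (iter i f x)) ->
  forall j x i, (0 < i < N)%N -> greedy_marker f g N B j x ->
    ~ greedy_marker f g N B j (iter i f x).
Proof.
move=> fK hB; elim=> [//|j IHj] x i iN /=.
have iltN : (i < N)%N by case/andP: iN.
move=> [Ax|[Bx nx]] [Afx|[Bfx nfx]].
- exact: IHj Ax Afx.
- by apply: nfx; exists i => //; right; rewrite /= iter_cancel.
- by apply: nx; exists i => //; left.
- exact: hB Bx Bfx.
Qed.

Lemma greedy_marker_subset {T : Type} (f g : T -> T) N (B : nat -> set T) j k :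
  (j <= k)%N -> greedy_marker f g N B j `<=` greedy_marker f g N B k.
Proof.
elim: k => [|k IHk]; first by rewrite leqn0 => /eqP ->.
by rewrite leq_eqVlt => /predU1P[->//|/IHk sjk] x /sjk; left.
Qed.

Section Marker.
Context {d} {T : measurableType d} {R : realType}.
Variables (mu : {measure set T -> \bar R}) (f g : T -> T).
Hypotheses (fK : cancel f g) (mf : measurable_fun setT f)
  (mg : measurable_fun setT g).

Lemma measurable_fun_iter (h : T -> T) n :
  measurable_fun setT h -> measurable_fun setT (iter n h).
Proof.
move=> mh; elim: n => [|n IHn]; first exact: measurable_id.
exact: (measurableT_comp mh IHn).
Qed.

Lemma measurable_greedy_marker N (B : nat -> set T) j :
  (forall j, measurable (B j)) -> measurable (greedy_marker f g N B j).
Proof.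
move=> mB; elim: j => [|j IHj] /=; first exact: measurable0.
apply: measurableU => //; apply: measurableD => //.
apply: bigcup_measurable => i _; apply: measurableU;
  by apply: measurable_preimageT => //; exact: measurable_fun_iter.
Qed.

(** The union of the greedy stages works: a point of [B j] refused at stage [j+1] is fewer than [N]
    steps away from stage [j]. *)
Lemma marker_exists N (B : nat -> set T) : (0 < N)%N ->
  (forall j, measurable (B j)) ->
  (forall j x i, (0 < i < N)%N -> B j x -> ~ B j (iter i f x)) ->
  exists A, [/\ measurable A,
    forall x i, (0 < i < N)%N -> A x -> ~ A (iter i f x) &
    forall x, (\bigcup_j B j) x ->
      exists2 i, (i < N)%N & A (iter i f x) \/ A (iter i g x)].
Proof.
move=> N0 mB hB; pose G := greedy_marker f g N B.
exists (\bigcup_j G j); split.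
- by apply: bigcup_measurable => j _; exact: measurable_greedy_marker.
- move=> x i iN [j _ Gj] [k _ Gk].
  have Gmono := greedy_marker_subset f g N B.
  apply: (greedy_marker_disjoint f g N B fK hB (maxn j k) x i iN).
    exact: (Gmono _ _ (leq_maxl j k)).
  exact: (Gmono _ _ (leq_maxr j k)).
- move=> x [j _ Bx].
  have [[i iN H]|nx] := pselect
    ((\bigcup_(i in `I_N) (iter i f @^-1` G j `|` iter i g @^-1` G j)) x).
    by exists i => //; case: H => H; [left|right]; exists j.
  by exists 0%N => //; left; exists j.+1 => //; right.
Qed.

(** The preimages of [A] under [f^k], for [k < N], are pairwise disjoint and of equal measure. *)
Lemma marker_measure_le N A : measure_preserving mu f -> measurable A ->
  (forall x i, (0 < i < N)%N -> A x -> ~ A (iter i f x)) ->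
  (N%:R%:E * mu A <= mu setT)%E.
Proof.
move=> pf mA dA; pose F k := iter k f @^-1` A.
have mF k : measurable (F k).
  by apply: measurable_preimageT => //; exact: measurable_fun_iter.
have mU : measurable (\big[setU/set0]_(k < N) F k) by exact: bigsetU_measurable.
have muF k : mu (F k) = mu A by exact: (measure_preserving_iter _ _ _ pf).2.
have tF : trivIset `I_N F.
  suff H i j x : (i < j < N)%N -> F i x -> F j x -> False.
    move=> i j iN jN [x [Fi Fj]]; have [ij|ji|//] := ltngtP i j; exfalso.
      by apply: (H i j x) => //; rewrite ij.
    by apply: (H j i x) => //; rewrite ji.
  move=> ijN Fi Fj.
  have /(_ (iter i f x) (j - i)%N) := dA.
  apply => //; first by lia.
  by rewrite -iterD subnK//; lia.
have <- : (\sum_(k < N) mu (F k) = N%:R%:E * mu A)%E.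
  by under eq_bigr do rewrite muF; rewrite sumr_const card_ord mule_natl.
rewrite -measure_semi_additive_ord_I//.
by apply: le_measure; rewrite ?inE//; exact: measurableT.
Qed.

End Marker.

(** * Markers for maps of the real line *)

Section RealMarker.
Context {R : realType}.
Local Notation X := (measurableTypeR R).

(** A countable base of balls; numbers that code no ball give the empty set. *)
Definition rat_ball (j : nat) : set X :=
  if unpickle j is Some (q, n) then ball (ratr q : R) (n.+1%:R^-1 : R) else set0.

Lemma measurable_rat_ball j : measurable (rat_ball j).
Proof.
rewrite /rat_ball; case: unpickle => [[q n]|]; last exact: measurable0.
exact: measurable_ball.
Qed.

Lemma rat_ball_separate (x e : R) : 0 < e ->
  exists j, rat_ball j x /\ forall y : R, e <= `|x - y| -> ~ rat_ball j y.
Proof.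
move=> e0.
have [n ne] : exists n, n.+1%:R^-1 < e / 2.
  have e20 : 0 < e / 2 by rewrite divr_gt0.
  exists (Num.truncn (e / 2)^-1).
  by rewrite invf_plt ?posrE// truncnS_gt.
have n0 : 0 < (n.+1%:R^-1 : R) by rewrite invr_gt0.
have hj q : rat_ball (pickle (q, n)) = ball (ratr q : R) (n.+1%:R^-1 : R).
  by rewrite /rat_ball pickleK.
move: (n.+1%:R^-1 : R) n0 ne hj => u u0 ue hj.
have [|q] := @rat_in_itvoo R (x - u) (x + u); first by lra.
rewrite in_itv/= => /andP[q1 q2].
exists (pickle (q, n)); rewrite hj; split.
  by rewrite /ball/= ltr_norml; lra.
move=> y; rewrite /ball /= ltr_norml => xy /andP[y1 y2].
have : `|x - y| < e by rewrite ltr_norml; lra.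
lra.
Qed.

(** [B j] keeps the points of a rational ball whose next [N-1] iterates lie outside it. A
    nonperiodic point is at positive distance from these iterates, so a small enough ball puts it in
    some [B j]. *)
Lemma aperiodic_marker (f g : X -> X) N : (0 < N)%N ->
  cancel f g -> measurable_fun setT f -> measurable_fun setT g ->
  exists A, [/\ measurable A,
    forall x i, (0 < i < N)%N -> A x -> ~ A (iter i f x) &
    forall x, (forall n, (0 < n)%N -> iter n f x <> x) ->
      exists2 i, (i < N)%N & A (iter i f x) \/ A (iter i g x)].
Proof.
move=> N0 fK mf mg.
pose B j := rat_ball j `&`
  \bigcap_(i in [set i | (0 < i < N)%N]) iter i f @^-1` (~` rat_ball j).
have [||A [mA dA cA]] := marker_exists f g fK mf mg N B N0.
- move=> j; apply: measurableI; first exact: measurable_rat_ball.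
  apply: bigcap_measurableType => i _.
  apply: measurable_preimageT; first exact: measurable_fun_iter.
  by apply: measurableC; exact: measurable_rat_ball.
- by move=> j x i iN [_ /(_ i iN) h] [/h].
exists A; split => // x px; apply: cA.
suff [e e0 he] : exists2 e : R, 0 < e &
    forall i, (0 < i < N)%N -> e <= `|x - iter i f x|.
  have [j [jx hj]] := rat_ball_separate x e e0.
  by exists j => //; split => // i iN; exact/hj/he.
elim: N {N0 B A mA dA} => [|N [e e0 he]]; first by exists 1 => // i; lia.
have [->|N0] := posnP N; first by exists 1 => // i; lia.
exists (Num.min e `|x - iter N f x|).
  rewrite lt_min e0 normr_gt0 subr_eq0; apply/eqP => /esym; exact: px.
move=> i /andP[i0]; rewrite ltnS leq_eqVlt => /predU1P[->|iN].
  by rewrite ge_min lexx orbT.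
by rewrite ge_min he// i0.
Qed.

End RealMarker.

(** * Tower maps *)

(* [tower_map A S r M z] is S^j (r^j z), with j the first time that the r-orbit
   of z meets A, and j = M if that does not happen before time M. *)
Fixpoint tower_map {U : Type} (A : set U) (S r : U -> U) (M : nat) (z : U) : U :=
  if M is M'.+1 then
    if `[< A z >] then z else S (tower_map A S r M' (r z))
  else z.

Section TowerMap.
Context {U X : Type} (p : U -> X) (A : set X).
Implicit Types (S r : U -> U).

Lemma tower_map_base S r (S0 r0 : X -> X) M z : cancel r0 S0 ->
  (forall z, p (S z) = S0 (p z)) -> (forall z, p (r z) = r0 (p z)) ->
  p (tower_map (p @^-1` A) S r M z) = p z.
Proof.
move=> r0K pS pr; elim: M z => [//|M IHM] z /=.
by case: asboolP => // _; rewrite pS IHM pr r0K.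
Qed.

(** [S^j r^j] is undone by [r'^j S'^j], again a tower map; the base point is unchanged and decides
    [j], so both stop at the same [j]. *)
Lemma tower_map_cancel S r S' r' (S0 r0 : X -> X) M : cancel r0 S0 ->
  (forall z, p (S z) = S0 (p z)) -> (forall z, p (r z) = r0 (p z)) ->
  cancel S S' -> cancel r r' ->
  cancel (tower_map (p @^-1` A) S r M) (tower_map (p @^-1` A) r' S' M).
Proof.
move=> r0K pS pr SK rK; elim: M => [//|M IHM] z /=.
have [Az|nAz] := asboolP ((p @^-1` A) z); first by rewrite asboolT.
rewrite asboolF /=; first by rewrite SK IHM rK.
by rewrite /preimage/= pS (tower_map_base S r S0 r0)// pr r0K.
Qed.

(** The recursion stops at the first visit to [A], before the bound is felt. The spare step pays for
    one unfolding in [coboundary_approximation]. *)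
Lemma tower_map_stable S r (r0 : X -> X) M z :
  (forall z, p (r z) = r0 (p z)) ->
  (exists2 i, (i < M)%N & A (iter i r0 (p z))) ->
  tower_map (p @^-1` A) S r M.+1 z = tower_map (p @^-1` A) S r M z.
Proof.
move=> pr; elim: M z => [|M IHM] z [i iM Ai]; first by [].
rewrite [RHS]/= [LHS]/=; case: asboolP => // nA; congr S.
apply: IHM; case: i iM Ai => [|i] iM Ai; first by case: nA.
by exists i; rewrite // pr -iterSr.
Qed.

End TowerMap.

Lemma measurable_tower_map {d} {U : measurableType d} (A : set U) (S r : U -> U) M :
  measurable A -> measurable_fun setT S -> measurable_fun setT r ->
  measurable_fun setT (tower_map A S r M).
Proof.
move=> mA mS mr; elim: M => [|M IHM]; first exact: measurable_id.
apply: (measurable_fun_ifT _ (measurable_id (D := setT))).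
  apply: (measurable_fun_bool true); rewrite setTI.
  by rewrite (_ : _ @^-1` _ = A)//; apply/seteqP; split=> x /asboolP.
exact: (measurableT_comp mS (measurableT_comp IHM mr)).
Qed.

(** * Extensions and their fibre maps *)

Section Extensions.
Context {R : realType}.
Local Notation X := (measurableTypeR R).
Local Notation m := (@leb01 R).
Local Notation mu := (@leb01sq R).
Implicit Types (f g : X -> X) (S T : X * X -> X * X).

Lemma leb01T : m setT = 1%E.
Proof.
rewrite /leb01 /mrestr setTI /unit_itv.
by rewrite lebesgue_measure_itv /= lte01 EFinN sube0.
Qed.

Lemma leb01sqE (E : set (X * X)) : mu E = (\int[m]_x m (xsection E x))%E.
Proof. by []. Qed.

Lemma leb01sqX (A B : set X) : measurable A -> measurable B ->
  mu (A `*` B) = (m A * m B)%E.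
Proof. by move=> mA mB; rewrite /leb01sq product_measure1E. Qed.

Lemma leb01sqT : mu setT = 1%E.
Proof. by rewrite -setXTT leb01sqX// leb01T mule1. Qed.

Lemma ge0_integral_measure_preserving f (h : X -> \bar R) :
  measure_preserving m f -> measurable_fun setT h -> (forall x, 0 <= h x)%E ->
  (\int[m]_x h (f x) = \int[m]_x h x)%E.
Proof.
move=> [mf pf] mh h0.
have := @ge0_integral_pushforward _ _ _ _ R f mf m setT h measurableT mh.
rewrite preimage_setT => <-; last by move=> y _.
by apply: eq_measure_integral => A mA _; exact: pf.
Qed.

(** Fubini: the section of [S^-1 E] at [x] is the preimage, under the fibre map at [x], of the
    section of [E] at [f x]; the integral over the base is then invariant under [f]. *)
Lemma measure_preserving_fiber S f :
  measurable_fun setT S -> (forall z, (S z).1 = f z.1) ->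
  measure_preserving m f ->
  (forall x, measure_preserving m (fun y => (S (x, y)).2)) ->
  measure_preserving mu S.
Proof.
move=> mS Sf pf pS; split => // E mE; rewrite !leb01sqE.
rewrite -(ge0_integral_measure_preserving f (fun x => m (xsection E x)))//.
- apply: eq_integral => x _.
  rewrite -((pS x).2 (xsection E (f x))); last exact: measurable_xsection.
  congr (m _); apply/seteqP; split => y.
    by rewrite /xsection/= !inE /= [S _]surjective_pairing Sf.
  by rewrite /xsection/= !inE /= [S _]surjective_pairing Sf.
- exact: measurable_fun_xsection.
Qed.

Lemma inv_mpt_inverse {d} {V : measurableType d} (nu : {measure set V -> \bar R})
    (u v : V -> V) : cancel u v -> cancel v u -> inv_mpt nu u -> inv_mpt nu v.
Proof.
move=> uK vK [w [uw wu pu pw]].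
have -> : v = w by apply/funext => x; rewrite -[x in LHS]wu uK.
by exists u.
Qed.

Lemma extensions_comp f g S T : extensions f S -> extensions g T ->
  extensions (f \o g) (S \o T).
Proof.
move=> [iS Sf fS] [iT Tg fT]; split => [|x y|x].
- exact: inv_mpt_comp.
- by rewrite /= [T _]surjective_pairing Sf Tg.
- rewrite [X in inv_mpt _ X](_ : _ =
    (fun y => (S (g x, y)).2) \o (fun y => (T (x, y)).2)).
    exact: inv_mpt_comp.
  by apply/funext => y /=; rewrite -(Tg x y) -surjective_pairing.
Qed.

Lemma extensions_inverse f g S T : cancel f g -> cancel g f ->
  cancel S T -> cancel T S -> extensions f S -> extensions g T.
Proof.
move=> fK gK SK TK [iS Sf fS].
have Tg x y : (T (x, y)).1 = g x.
  apply: (canRL fK); rewrite -(Sf _ (T (x, y)).2).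
  by rewrite -surjective_pairing TK.
split => // [|x]; first exact: inv_mpt_inverse iS.
apply: (inv_mpt_inverse _ (fun y => (S (g x, y)).2)) => // y /=.
- rewrite (_ : (x, _) = S (g x, y)) ?SK//.
  by rewrite [RHS]surjective_pairing Sf gK.
- by rewrite -(Tg x y) -surjective_pairing TK.
Qed.

Lemma extensions_prod_id f : inv_mpt m f ->
  extensions f (fun z => (f z.1, z.2)).
Proof.
move=> [g [fK gK pf pg]].
have pr u : measure_preserving m u ->
    measure_preserving mu (fun z : X * X => (u z.1, z.2)).
  move=> pu; apply: (measure_preserving_fiber _ u) => // [|x].
    apply: measurable_fun_pair => //.
    by apply: measurableT_comp => //; exact: pu.1.
  exact: measure_preserving_id.
split => // [|x]; last exact: inv_mpt_id.
exists (fun z => (g z.1, z.2)); split; [| |exact: pr..].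
- by move=> [x y] /=; rewrite fK.
- by move=> [x y] /=; rewrite gK.
Qed.

(** By induction on [M], a fibre map is the identity over [A] and elsewhere a composite of three
    fibre maps. The inverse is the tower map of [r'] and [S'], so both auxiliary facts are stated
    for general [S1] and [r1]. *)
Lemma extensions_tower_map A f g S r M : cancel f g -> cancel g f ->
  measurable A -> extensions f S -> extensions g r ->
  extensions id (tower_map (fst @^-1` A) S r M).
Proof.
move=> fK gK mA eS er.
have [S' [SK S'K pS pS']] := let: And3 i _ _ := eS in i.
have [r' [rK r'K pr pr']] := let: And3 i _ _ := er in i.
have Sf z : (S z).1 = f z.1 by case: z => x y; case: eS.
have rg z : (r z).1 = g z.1 by case: z => x y; case: er.
have eS' : extensions g S' by exact: extensions_inverse eS.
have er' : extensions f r' by exact: extensions_inverse er.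
have S'g z : (S' z).1 = g z.1 by case: z => x y; case: eS'.
have r'f z : (r' z).1 = f z.1 by case: z => x y; case: er'.
have fibers S1 r1 : extensions f S1 -> extensions g r1 -> forall M x,
    inv_mpt m (fun y => (tower_map (fst @^-1` A) S1 r1 M (x, y)).2).
  move=> [_ S1f fS1] [_ r1g fr1].
  have r1g' z : (r1 z).1 = g z.1 by case: z.
  have S1f' z : (S1 z).1 = f z.1 by case: z.
  elim=> [|k IHk] x; first exact: inv_mpt_id.
  have [Ax|nAx] := pselect (A x).
    rewrite [X in inv_mpt _ X](_ : _ = id); first exact: inv_mpt_id.
    by apply/funext => y /=; rewrite asboolT.
  rewrite [X in inv_mpt _ X](_ : _ = (fun y => (S1 (g x, y)).2) \o
    ((fun y => (tower_map (fst @^-1` A) S1 r1 k (g x, y)).2) \o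
     (fun y => (r1 (x, y)).2))).
    by apply: inv_mpt_comp => //; exact: inv_mpt_comp.
  apply/funext => y /=; rewrite asboolF//.
  rewrite -{2}(r1g x y) -[(_.1, _.2)]surjective_pairing.
  congr (S1 _).2; rewrite [LHS]surjective_pairing.
  by rewrite (tower_map_base _ _ S1 r1 f g)// r1g.
have preserving S1 r1 : measurable_fun setT S1 -> measurable_fun setT r1 ->
   extensions f S1 -> extensions g r1 ->
   measure_preserving mu (tower_map (fst @^-1` A) S1 r1 M).
  move=> mS1 mr1 eS1 er1; apply: (measure_preserving_fiber _ id).
  - apply: measurable_tower_map => //.
    by apply: measurable_preimageT => //; exact: measurable_fst.
  - move=> z; apply: (tower_map_base _ _ _ _ f g) => // -[x y].
      by case: eS1.
    by case: er1.
  - exact: measure_preserving_id.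
  - by move=> x; have [v [_ _ h _]] := fibers _ _ eS1 er1 M x.
split => [|x y|x]; last exact: fibers.
- exists (tower_map (fst @^-1` A) r' S' M); split.
  + exact: (tower_map_cancel _ _ _ _ _ _ f g).
  + exact: (tower_map_cancel _ _ _ _ _ _ f g).
  + by apply: preserving => //; [exact: pS.1|exact: pr.1].
  + by apply: preserving => //; [exact: pr'.1|exact: pS'.1].
- exact: (tower_map_base _ _ _ _ f g).
Qed.

End Extensions.

(** * Square integrals of indicators *)

Section Indicators.
Context {d} {T : measurableType d} {R : realType}.
Variable mu : {measure set T -> \bar R}.

Lemma integral_sqr_indic (A : set T) : measurable A ->
  (\int[mu]_x ((\1_A x : R) ^+ 2)%:E = mu A)%E.
Proof.
move=> mA; transitivity (\int[mu]_x (\1_A x : R)%:E)%E.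
  by apply: eq_integral => x _; rewrite indicE; case: (x \in A); rewrite /= ?expr1n ?expr0n.
by rewrite integral_indic// setIT.
Qed.

Lemma integral_sqr_indicB (A B : set T) : measurable A -> measurable B ->
  (\int[mu]_x ((\1_A x - \1_B x : R) ^+ 2)%:E = mu (B `+` A))%E.
Proof.
move=> mA mB; rewrite -integral_sqr_indic; last exact: measurable_setY.
apply: eq_integral => x _; congr (_%:E); rewrite !indicE.
have [Ax|nAx] := pselect (A x); have [Bx|nBx] := pselect (B x).
- rewrite (mem_set Ax) (mem_set Bx) memNset ?subrr ?expr0n//=; tauto.
- rewrite (mem_set Ax) (memNset nBx) mem_set ?subr0 ?expr1n//=; tauto.
- rewrite (memNset nAx) (mem_set Bx) mem_set ?sub0r ?sqrrN ?expr1n//=; tauto.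
- rewrite (memNset nAx) (memNset nBx) memNset ?subrr ?expr0n//=; tauto.
Qed.

Lemma L2_indic (A : set T) : measurable A -> (mu A < +oo)%E -> L2 mu (\1_A : T -> R).
Proof.
by move=> mA muA; split; [exact: measurable_indic|rewrite integral_sqr_indic].
Qed.

End Indicators.

(** * Rigidity on the product, the test set and a bound on means *)

Section Estimates.
Context {R : realType}.
Local Notation X := (measurableTypeR R).
Local Notation m := (@leb01 R).
Local Notation mu := (@leb01sq R).

Lemma leb01_le1 (A : set X) : measurable A -> (m A <= 1)%E.
Proof. by move=> mA; rewrite -leb01T; apply: le_measure; rewrite ?inE. Qed.

Lemma leb01sq_le1 (A : set (X * X)) : measurable A -> (mu A <= 1)%E.
Proof. by move=> mA; rewrite -leb01sqT; apply: le_measure; rewrite ?inE. Qed.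

Lemma leb01_lty (A : set X) : measurable A -> (m A < +oo)%E.
Proof. by move=> mA; exact: le_lt_trans (leb01_le1 _ mA) (ltry _). Qed.

Lemma leb01sq_lty (A : set (X * X)) : measurable A -> (mu A < +oo)%E.
Proof. by move=> mA; exact: le_lt_trans (leb01sq_le1 _ mA) (ltry _). Qed.

(** Uniqueness of the product measure. Sections at fixed [y] are the ones that [T0 * id] acts on. *)
Lemma leb01sqE_ysection (A : set (X * X)) : measurable A ->
  mu A = (\int[m]_y m (ysection A y))%E.
Proof.
move=> mA; transitivity ((m \x^ m)%E A) => //.
apply: (@product_measure_unique _ _ _ _ _ m m (m \x^ m)%E) => // B C mB mC.
exact: product_measure2E.
Qed.

Lemma iter_prod_id (f : X -> X) n (z : X * X) :
  iter n (fun z => (f z.1, z.2)) z = (iter n f z.1, z.2).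
Proof. by elim: n => [|n /= ->//]; case: z. Qed.

(** At each fixed [y], rigidity applied to the indicator of the section of [A] gives convergence to
    0; dominated convergence with bound 1 then integrates over [y]. *)
Lemma rigid_prod_id (f : X -> X) : measure_preserving m f -> rigid f ->
  exists2 nk : nat -> nat, (forall k, (nk k < nk k.+1)%N) &
  forall A : set (X * X), measurable A ->
    (mu (A `+` iter (nk k) (fun z => (f z.1, z.2)) @^-1` A) @[k --> \oo] --> 0)%E.
Proof.
move=> pf [nk [nk_lt nkc]]; exists nk => // A mA.
pose t := fun z : X * X => (f z.1, z.2).
have mfn n : measurable_fun setT (iter n f).
  exact: (measure_preserving_iter _ _ n pf).1.
have mt n : measurable_fun setT (iter n t).
  rewrite (_ : iter n t = fun z => (iter n f z.1, z.2)); last first.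
    by apply/funext => z; exact: iter_prod_id.
  by apply: measurable_fun_pair => //; exact: measurableT_comp.
pose D k := A `+` iter (nk k) t @^-1` A.
have mD k : measurable (D k).
  by apply: measurable_setY => //; exact: measurable_preimageT.
have yD k y : ysection (D k) y =
    ysection A y `+` iter (nk k) f @^-1` (ysection A y).
  rewrite !ysectionE /D; apply/seteqP.
  by split => x; rewrite /preimage /setY/= !iter_prod_id.
rewrite (_ : (fun k => _) = (fun k => \int[m]_y m (ysection (D k) y))%E); last first.
  by apply/funext => k; exact: (leb01sqE_ysection _ (mD k)).
have [|||||_ _] := @dominated_convergence _ _ R m setT measurableT
  (fun k y => m (ysection (D k) y)) (cst 0%E) (cst 1%E).
- by move=> k; exact: measurable_fun_ysection.
- exact: measurable_cst.
- apply: aeW => y _; under eq_fun do rewrite yD.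
  have mAy : measurable (ysection A y) by exact: measurable_ysection.
  have mB k : measurable (iter (nk k) f @^-1` (ysection A y)).
    exact: measurable_preimageT.
  have /Lnorm2_cvg0 := nkc _ (L2_indic m _ mAy (leb01_lty _ mAy)).
  suff -> : (fun k => m (ysection A y `+` iter (nk k) f @^-1` (ysection A y))) =
    (fun k => \int[m]_x ((\1_(ysection A y) (iter (nk k) f x)
                          - \1_(ysection A y) x : R) ^+ 2)%:E)%E by [].
  by apply/funext => k; rewrite -(integral_sqr_indicB m (iter (nk k) f @^-1` (ysection A y))).
- exact: (finite_measure_integrable_cst m 1).
- apply: aeW => y k _; rewrite gee0_abs//.
  by apply: leb01_le1; exact: measurable_ysection.
- by rewrite integral0.
Qed.

(** The set [X * [0, 1/2]] up to a null set: the carrier is the whole line, and [leb01] ignores what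
    lies outside the unit interval. *)
Definition lower_half : set (X * X) := setT `*` [set y : X | y <= 2^-1].

Lemma measurable_lower_half : measurable lower_half.
Proof.
apply: measurableX => //.
rewrite (_ : [set y : X | y <= 2^-1] = `]-oo, 2^-1]%classic).
  exact: measurable_itv.
by apply/seteqP; split => y /=; rewrite in_itv.
Qed.

Lemma xsection_lower_half x : m (xsection lower_half x) = (2^-1)%:E.
Proof.
rewrite /leb01 /mrestr /unit_itv (_ : _ `&` _ = `[0, 2^-1]%classic).
  by rewrite lebesgue_measure_itv /= lte_fin invr_gt0 ltr0n/= EFinN sube0.
rewrite xsectionE; apply/seteqP; split => y; rewrite /preimage /= !in_itv/=.
  by move=> [[_ ->] /andP[->]].
by move=> /andP[y0 y1]; split => //; rewrite y0; lra.
Qed.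

Lemma leb01sq_lower_half : mu lower_half = (2^-1)%:E.
Proof.
rewrite leb01sqE; under eq_integral do rewrite xsection_lower_half.
by rewrite integral_cst// [X in (_ * X)%E]leb01T mule1.
Qed.

Lemma L2_rel_indic (A : set (X * X)) : measurable A -> L2_rel (\1_A : X * X -> R).
Proof.
move=> mA; split; first exact: (L2_indic mu _ mA (leb01sq_lty _ mA)).
exists 1; apply: aeW => x.
have mAx : measurable (xsection A x) by exact: measurable_xsection.
apply: le_trans (leb01_le1 _ mAx); rewrite -(integral_sqr_indic m _ mAx).
rewrite le_eqVlt; apply/orP; left; apply/eqP.
by apply: eq_integral => y _; rewrite !indicE mem_xsection.
Qed.

Lemma condX_indic (A : set (X * X)) x : measurable A ->
  condX (\1_A : X * X -> R) x = fine (m (xsection A x)).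
Proof.
move=> mA; rewrite /condX -[xsection A x]setIT.
rewrite -(integral_indic m measurableT); last exact: measurable_xsection.
by congr fine; apply: eq_integral => y _; rewrite !indicE mem_xsection.
Qed.

(** Pointwise [c/4 <= (c - 1/4)^2 + 5/64], the difference being [(c - 3/8)^2]. Integrating bounds a
    quarter of the mean by less than [1/64 + 5/64 = 3/32]. *)
Lemma mean_lt_of_sqr_dist (c : X -> R) : measurable_fun setT c ->
  (forall x, 0 <= c x) ->
  (\int[m]_x ((c x - 4^-1) ^+ 2)%:E < (64^-1)%:E)%E ->
  (\int[m]_x (c x)%:E < (3 / 8)%:E)%E.
Proof.
move=> mc c0 hc.
have mE : measurable_fun setT (fun x => (c x)%:E) by exact/measurable_EFinP.
have ms : measurable_fun setT (fun x => ((c x - 4^-1) ^+ 2)%:E).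
  apply/measurable_EFinP; apply: measurable_funX.
  by apply: measurable_funB => //; exact: measurable_cst.
have key : ((4^-1)%:E * \int[m]_x (c x)%:E <=
    \int[m]_x ((c x - 4^-1) ^+ 2)%:E + (5 / 64)%:E)%E.
  rewrite -ge0_integralZl_EFin ?invr_ge0//; last by move=> x _; rewrite lee_fin.
  have -> : ((5 / 64 : R)%:E = \int[m]_x (5 / 64 : R)%:E)%E.
    by rewrite integral_cst// [X in (_ * X)%E]leb01T mule1.
  rewrite -ge0_integralD//; last by move=> x _; rewrite lee_fin sqr_ge0.
  apply: ge0_le_integral => //.
  - by move=> x _; rewrite mule_ge0// lee_fin ?invr_ge0.
  - by apply/measurable_EFinP; apply: measurable_funM.
  - by apply: emeasurable_funD => //; exact: measurable_cst.
  - move=> x _; rewrite lee_fin -subr_ge0.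
    have -> : (c x - 4^-1) ^+ 2 + 5 / 64 - 4^-1 * c x = (c x - 3 / 8) ^+ 2 by field.
    exact: sqr_ge0.
have I0 : (0 <= \int[m]_x (c x)%:E)%E by apply: integral_ge0 => x _; rewrite lee_fin.
have S0 : (0 <= \int[m]_x ((c x - 4^-1) ^+ 2)%:E)%E.
  by apply: integral_ge0 => x _; rewrite lee_fin sqr_ge0.
move: I0 S0 key hc.
case: (\int[m]_x ((c x - 4^-1) ^+ 2)%:E)%E => [s| |]//.
case: (\int[m]_x (c x)%:E)%E => [i| |]//; rewrite -?EFinM -?EFinD ?lee_fin ?lte_fin.
  lra.
by rewrite gt0_muley ?lte_fin ?invr_gt0.
Qed.

End Estimates.

(** * Returning extensions: avoided by mixing, open and dense *)

Lemma inv_mpt_iter {d} {T : measurableType d} {R : realType}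
    (mu : {measure set T -> \bar R}) (f : T -> T) n :
  inv_mpt mu f -> inv_mpt mu (iter n f).
Proof.
move=> If; elim: n => [|n IHn]; first exact: inv_mpt_id.
exact: (inv_mpt_comp _ _ (iter n f)).
Qed.

Lemma inv_mpt_setY_image {d} {T : measurableType d} {R : realType}
    (mu : {measure set T -> \bar R}) (f : T -> T) (A : set T) :
  inv_mpt mu f -> measurable A -> mu ((f @` A) `+` A) = mu (A `+` f @^-1` A).
Proof.
move=> If mA; have [g [fK gK [mf pf] _]] := If.
have [mfA _] := inv_mpt_image mu _ _ If mA.
rewrite -pf; last exact: measurable_setY.
congr (mu (_ `+` _)); rewrite (can2_image_preimage f g)//.
by apply/funext => x /=; rewrite fK.
Qed.

Section Category.
Context {R : realType}.
Local Notation X := (measurableTypeR R).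
Local Notation m := (@leb01 R).
Local Notation mu := (@leb01sq R).
Local Notation E := (@lower_half R).

Let mE : measurable E := measurable_lower_half.

(** Every fibre of [E] has measure 1/2, so mixing sends the conditional correlation [c] of [E] with
    itself to 1/4 in norm; a distance below 1/8 forces its mean below 3/8. *)
Lemma mixing_correlation (T0 : X -> X) (T : X * X -> X * X) :
  mixing_extensions T0 T ->
  \forall n \near \oo, (mu (iter n T @^-1` E `&` E) < (3 / 8)%:E)%E.
Proof.
move=> [[iT _ _] mixT].
have mTn n : measurable_fun setT (iter n T).
  by have [_ [_ _ [mTn _] _]] := inv_mpt_iter _ _ n iT.
have mG n : measurable (iter n T @^-1` E `&` E).
  by apply: measurableI => //; exact: measurable_preimageT.
have := mixT _ _ (L2_rel_indic _ mE) (L2_rel_indic _ mE).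
move=> /Lnorm2_cvg0 c0.
have e0 : (0 < (64^-1)%:E :> \bar R)%E by rewrite lte_fin invr_gt0.
have : \forall n \near \oo, (\int[m]_x ((condX (fun z => \1_E (iter n T z) * \1_E z) x
   - condX (\1_E : X * X -> R) (iter n T0 x) * condX (\1_E : X * X -> R) x) ^+ 2)%:E
     < (64^-1)%:E)%E.
  exact: (c0 _ (open_ereal_lt' e0)).
apply: filterS => n hn.
pose c x := fine (m (xsection (iter n T @^-1` E `&` E) x)).
have mc : measurable_fun setT (fun x => m (xsection (iter n T @^-1` E `&` E) x)).
  exact: measurable_fun_xsection.
have cE x : ((c x)%:E = m (xsection (iter n T @^-1` E `&` E) x)).
  by rewrite fineK// fin_num_measure//; exact: measurable_xsection.
rewrite leb01sqE; under eq_integral do rewrite -cE.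
apply: mean_lt_of_sqr_dist.
- exact: (measurableT_comp (fine_measurable measurableT) mc).
- by move=> x; rewrite fine_ge0.
- move: hn; congr (_ < _)%E; apply: eq_integral => x _; congr ((_ - _) ^+ 2)%:E.
    rewrite /c -condX_indic//; congr condX; apply/funext => z.
    by rewrite !indicE in_setI -natrM mulnb.
  by rewrite !condX_indic// !xsection_lower_half /= -invfM; congr _^-1; ring.
Qed.

(** The set [V_n] of the overview. A single late near-return suffices, so a rigidity sequence can
    supply it. *)
Definition returning (T0 : X -> X) (n : nat) : set (X * X -> X * X) :=
  [set S | extensions T0 S /\
    exists2 k, (n <= k)%N & (mu ((iter k S @` E) `+` E) < (8^-1)%:E)%E].

(** [E] is covered by its overlap with [T^-k E] and by their symmetric difference, so a return would
    give [1/2 < 3/8 + 1/8]. *)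
Lemma mixing_not_returning (T0 : X -> X) (T : X * X -> X * X) :
  mixing_extensions T0 T -> exists n, ~ returning T0 n T.
Proof.
move=> mixT; have [[iT _ _] _] := mixT.
have [N _ hN] := mixing_correlation _ _ mixT.
exists N => -[_ [k Nk]].
have Ik := inv_mpt_iter mu _ k iT.
rewrite inv_mpt_setY_image// => hk.
have mTk : measurable (iter k T @^-1` E).
  by have [_ [_ _ [mTn _] _]] := Ik; exact: measurable_preimageT.
have := hN k Nk; set a := mu _ => ha.
have : (mu E <= a + mu (E `+` iter k T @^-1` E))%E.
  apply: le_trans (measureU2 mu _ _); last 2 first.
  - exact: measurableI.
  - exact: measurable_setY.
  apply: le_measure; rewrite ?inE//.
    by apply: measurableU; [exact: measurableI|exact: measurable_setY].
  move=> z Ez; have [TEz|nTEz] := pselect ((iter k T @^-1` E) z).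
    by left; split.
  by right; left; split.
rewrite leb01sq_lower_half; apply/negP; rewrite -ltNge.
apply: lt_le_trans (lteD ha hk) _.
by rewrite -EFinD lee_fin; lra.
Qed.

Lemma returning_open (T0 : X -> X) n :
  weak_open mu (extensions T0) (returning T0 n).
Proof.
split=> [S []//|S0 [eS0 [k nk hk]]].
have I0 : inv_mpt mu S0 by case: eS0.
have mi j : measurable (iter j S0 @` E).
  exact: (inv_mpt_image mu _ _ (inv_mpt_iter mu _ j I0) mE).1.
have fink : mu ((iter k S0 @` E) `+` E) \is a fin_num.
  rewrite ge0_fin_numE//; apply: leb01sq_lty; exact: measurable_setY.
move: hk; rewrite -(fineK fink) lte_fin; set r := fine _ => hr.
(* The slack below 1/8 is shared among [k] telescoping steps; dividing by [k+1] keeps the total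
   strictly below it and covers [k = 0]. *)
pose e := (8^-1 - r) / k.+1%:R.
have e0 : 0 < e by rewrite divr_gt0// subr_gt0.
exists [seq iter j S0 @` E | j <- iota 0 k], e; split => //.
  by move=> _ /mapP[j _ ->].
move=> S [eS hS]; split => //; exists k => //.
have IS : inv_mpt mu S by case: eS.
have mS j : measurable (iter j S @` E).
  exact: (inv_mpt_image mu _ _ (inv_mpt_iter mu _ j IS) mE).1.
apply: le_lt_trans (measure_setY_triangle mu _ _ _ (mS k) (mi k) mE) _.
apply: (@le_lt_trans _ _ ((k%:R * e)%:E + r%:E)%E).
  rewrite fineK//; apply: leeD => //; apply: iter_image_setY_le => // j jk.
  by apply/ltW/hS/mapP; exists j => //; rewrite mem_iota.
rewrite -EFinD lte_fin -ltrBrDr /e mulrCA gtr_pMr ?subr_gt0//.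
by rewrite ltr_pdivrMr// mul1r ltr_nat.
Qed.

(** Put [t = T0 * id] and [P z = S^j t^-j z], with [j] the time since the last visit to [A]. A step
    of [t] that does not land over [A] adds one to [j], so [P t = S P] there, provided that the past
    visit falls within the bound. *)
Lemma coboundary_approximation (T0 : X -> X) (S : X * X -> X * X) (e : R) :
  inv_mpt m T0 -> antiperiodic T0 -> extensions T0 S -> 0 < e ->
  exists P Q D, [/\ extensions id P /\ extensions id Q, cancel P Q /\ cancel Q P,
    measurable D /\ (mu D + mu D < e%:E)%E &
    forall z, ~ D z -> P ((fun z => (T0 z.1, z.2)) (Q z)) = S z].
Proof.
move=> iT0 [B [mB B0 PB]] eS e0.
have [g [T0K gK [mT0 pT0] [mg pg]]] := iT0.
(* [A] has measure at most [1/N], and the exceptional set, with base [T0^-1 A] up to a null set, is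
   counted twice. *)
have [N N0 Ne] : exists2 N, (0 < N)%N & 2 / N%:R < e.
  exists (Num.truncn (2 / e)).+1 => //.
  by rewrite ltr_pdivrMr// mulrC -ltr_pdivrMr// truncnS_gt.
have [A [mA dA cA]] := aperiodic_marker T0 g N N0 T0K mT0 mg.
pose Hit := \bigcup_(r in `I_(2 * N)) iter r g @^-1` A.
have mHit : measurable Hit.
  apply: bigcup_measurable => r _; apply: measurable_preimageT => //.
  exact: measurable_fun_iter.
have nHit : ~` Hit `<=` B.
  move=> x nx; apply: PB; apply: contrapT => px; apply: nx.
  (* The marker property is two-sided, so it is applied at [T0^-N x]: a visit fewer than [N] steps
     from there, in either direction, is in the past of [x], at a time below [2N]. *)
  have [|i iN] := cA (iter N g x).
    move=> n n0 E1; apply: px; exists n; split => //.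
    have /= := congr1 (iter N T0) E1.
    by rewrite -iterD addnC iterD !(iter_cancel _ _ N gK).
  case=> Ai; last by exists (i + N)%N; rewrite /= ?iterD//; lia.
  exists (N - i)%N => /=; first by lia.
  move: Ai; rewrite -[in iter N _ _](subnKC (ltnW iN)) iterD.
  by rewrite (iter_cancel _ _ i gK).
pose t := fun z : X * X => (T0 z.1, z.2).
pose ti := fun z : X * X => (g z.1, z.2).
have tK : cancel t ti by case=> x y; rewrite /t /ti /= T0K.
have tiK : cancel ti t by case=> x y; rewrite /t /ti /= gK.
have [iS Sf fS] := eS; have [Si [SK SiK _ _]] := iS.
have et : extensions T0 t by exact: extensions_prod_id.
have eti : extensions g ti by exact: extensions_inverse et.
have eSi : extensions g Si by exact: extensions_inverse eS.
have Sf' z : (S z).1 = T0 z.1 by case: z.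
have Sig z : (Si z).1 = g z.1 by case: z => x y; case: eSi.
pose P := tower_map (fst @^-1` A) S ti (2 * N).
pose Q := tower_map (fst @^-1` A) t Si (2 * N).
have QK : cancel Q P by exact: (tower_map_cancel _ _ _ _ _ _ T0 g).
exists P, Q, ((T0 @^-1` (A `|` ~` Hit)) `*` setT); split.
- by split; exact: (extensions_tower_map A T0 g).
- by split => //; exact: (tower_map_cancel _ _ _ _ _ _ T0 g).
- have mD : measurable (A `|` ~` Hit) by apply: measurableU => //; exact: measurableC.
  have mTD : measurable (T0 @^-1` (A `|` ~` Hit)) by exact: measurable_preimageT.
  split; first exact: measurableX.
  rewrite leb01sqX// pT0// [X in (_ * X)%E]leb01T mule1.
  have -> : m (A `|` ~` Hit) = m A.
    apply: measureU0 => //; first exact: measurableC.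
    by apply: (@subset_measure0 _ _ _ m _ B) => //; exact: measurableC.
  have : (N%:R%:E * m A <= 1)%E.
    by rewrite -leb01T; exact: (marker_measure_le m T0 mT0 N A (conj mT0 pT0) mA dA).
  have := leb01_lty _ mA; have : (0 <= m A)%E by exact: measure_ge0.
  case: (m A) => [a| |]//; rewrite -EFinM -EFinD !lee_fin lte_fin => a0 _ Na.
  apply: le_lt_trans Ne; rewrite ler_pdivlMr ?ltr0n//.
  by rewrite mulrDl; lra.
- move=> w nD; rewrite -/(t (Q w)).
  have Qw : (Q w).1 = w.1 by exact: (tower_map_base _ _ _ _ T0 g).
  have nA : ~ A (t (Q w)).1 by move=> h; apply: nD; split => //; left; rewrite -Qw.
  have [r rN Ar] : Hit (t (Q w)).1.
    by apply: contrapT => h; apply: nD; split => //; right; rewrite -Qw.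
  (* With the bound raised by one, [P] unfolds to [S (P (ti (t (Q w))))], which is [S w]. *)
  rewrite /P -(tower_map_stable _ _ _ _ g)//; last by exists r.
  by rewrite /= asboolF// tK -/P QK.
Qed.

Lemma iter_conjugate {T U : Type} (P : U -> T) (Q : T -> U) (t : U -> U) n z :
  cancel P Q -> cancel Q P -> iter n (P \o t \o Q) z = P (iter n t (Q z)).
Proof. by move=> PK QK; elim: n => [|n /= ->]; rewrite ?QK//= PK. Qed.

(** The conjugate [P t Q] differs from [S] only on [D], and its powers displace [E] exactly as much
    as those of [t] displace [P^-1 E], which rigidity makes small. *)
Lemma returning_dense (T0 : X -> X) (S : X * X -> X * X) (e : R) n :
  inv_mpt m T0 -> antiperiodic T0 -> rigid T0 -> extensions T0 S -> 0 < e ->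
  exists2 S', returning T0 n S' & forall A, measurable A ->
    (mu ((S' @` A) `+` (S @` A)) < e%:E)%E.
Proof.
move=> iT0 aT0 rT0 eS e0.
have [P [Q [D [[eP eQ] [PK QK] [mD De] PSD]]]] :=
  coboundary_approximation _ _ _ iT0 aT0 eS e0.
pose t := fun z : X * X => (T0 z.1, z.2).
have et : extensions T0 t by exact: extensions_prod_id.
have eS' : extensions T0 (P \o t \o Q).
  exact: (extensions_comp T0 id _ _ (extensions_comp id T0 _ _ eP et) eQ).
have iS' : inv_mpt mu (P \o t \o Q) by case: eS'.
have iS : inv_mpt mu S by case: eS.
exists (P \o t \o Q); last first.
  by move=> A mA; apply: le_lt_trans (image_setY_neq_le mu _ _ _ D iS' iS mA mD _) De.
split => //.
have pT0 : measure_preserving m T0 by case: iT0 => ? [].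
have [nk nk_lt nkc] := rigid_prod_id _ pT0 rT0.
have [[_ [_ _ [mP _] _]] _ _] := eP; have [[_ [_ _ [mQ pQ] _]] _ _] := eQ.
have mF : measurable (P @^-1` E) by exact: measurable_preimageT.
have e8 : (0 < (8^-1)%:E :> \bar R)%E by rewrite lte_fin invr_gt0.
have [K _ hK] := nkc _ mF _ (open_ereal_lt' e8).
have nk_ge j : (j <= nk j)%N by elim: j => // j IHj; exact: leq_ltn_trans (nk_lt j).
(* Since [nk j >= j], the index [maxn n K] is late enough both for [n] and for the rigidity
   estimate. *)
exists (nk (maxn n K)); first exact: leq_trans (leq_maxl n K) (nk_ge _).
rewrite inv_mpt_setY_image//; last exact: inv_mpt_iter.
apply: le_lt_trans (hK (maxn n K) (leq_maxr n K)).
have mt : measurable_fun setT (iter (nk (maxn n K)) t).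
  by have [[_ [_ _ pt _]] _ _] := et; exact: (measure_preserving_iter mu _ _ pt).1.
(* The displacement of [P^-1 E] under [t] is pulled back by [Q]; as [P Q] is the identity, it
   becomes that of [E]. *)
rewrite -pQ; last by apply: measurable_setY => //; exact: measurable_preimageT.
rewrite le_eqVlt; apply/orP; left; apply/eqP; congr (mu _).
apply/seteqP; split => z; rewrite /setY /preimage /= iter_conjugate// QK; tauto.
Qed.

End Category.

Theorem theorem3p4 (R : realType) (T0 : measurableTypeR R -> measurableTypeR R) :
  inv_mpt (@leb01 R) T0 -> antiperiodic T0 -> rigid T0 ->
  weak_first_category (@leb01sq R) (extensions T0) (mixing_extensions T0).
Proof.
move=> iT0 aT0 rT0.
exists (fun n => mixing_extensions T0 `\` returning T0 n); split; last first.
  apply/seteqP; split => [T mixT|T [n _ []//]].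
  by have [n nT] := mixing_not_returning _ _ mixT; exists n.
move=> n; split; first by move=> T [[]].
(* A nonempty open [U] inside the closure of a piece would contain, by density, some [S'] in [V_n];
   but [V_n] is an open neighbourhood of [S'] that misses the piece. *)
rewrite -subset0 => S [U [[UG Uo] US Ucl]].
have [Es [e [e0 mEs hU]]] := Uo S US.
have [S' rS' hS'] := returning_dense _ _ _ n iT0 aT0 rT0 (UG _ US) e0.
have /Ucl [_ /(_ _ (returning_open T0 n) rS')[T [rT [_ /(_ rT)]]]] // : U S'.
by apply: hU; split => [|A /mEs]; [case: rS'|exact: hS'].
Qed.
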